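(* Let $M_I$ and $N_J$ be factor systems with limits $M$ and $N$ respectively, and assume Condition (D). Then $[M\to_{\mathcal F}N]$ is a limit of $[M_I\to N_J]$. Equivalently, there is an isomorphism $[\mathrm{elem}(M_I)\to_{\mathcal F}\mathrm{elem}(N_J)]\simeq\mathrm{elem}([M_I\to N_J])$.
   Context: For every non-empty directed preordered set $I$ a family $\mathcal F(I)$ of subsets is fixed, each cofinal, closed under supersets and finite intersections, containing all non-empty upward closed subsets. Condition (D): for all such $I,J$, $H\in\mathcal F(I\times J)$ and $I'\in\mathcal F(I)$ imply $\{j\mid\exists i\in I',(i,j)\in H\}\in\mathcal F(J)$. System $(M_I,\triangleright)$: pairwise disjoint sets $M_i$ with relations $\triangleright\subseteq M_{i'}\times M_i$ ($i\le i'$), reflexive for $i=i'$; $a_i\approx b_j$ iff some $c\in M_{i'}$, $i'\ge i,j$, has $c\triangleright a_i,c\triangleright b_j$; prefactor: $a_{i'}\approx a_i\iff a_{i'}\triangleright a_i$. Factor system: prefactor system with $\approx$-preserving $emb_{i,i'}:M_i\to M_{i'}$, $proj_{i',i}:M_{i'}\to M_i$ with $emb_{i,i}(a)\approx a$, $proj_{i,i}(a)\approx a$, $emb_{i',i''}\circ emb_{i,i'}(a)\approx emb_{i,i''}(a)$, $proj_{i',i}\circ proj_{i'',i'}(a)\approx proj_{i'',i}(a)$, $proj_{i',i}(emb_{i,i'}(a))\approx a$, and $a_{i'}\triangleright a_i\Rightarrow emb_{i',i''}(a_{i'})\triangleright a_i$, $a_{i''}\triangleright a_i\Rightarrow proj_{i'',i'}(a_{i''})\triangleright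 a_i$ ($i\le i'\le i''$). Function space $[M_I\to N_J]$: indices $i\to j\in I\times J$ (product order), states = $\approx$-preserving functions $M_i\to N_j$, $f'\triangleright f$ iff $a_{i'}\triangleright a_i\Rightarrow f'(a_{i'})\triangleright f(a_i)$, embeddings $f\mapsto emb_{j,j'}\circ f\circ proj_{i',i}$, projections $f'\mapsto proj_{j',j}\circ f'\circ emb_{i,i'}$. A target for $M_I$: a set $M$ with a relation $a\triangleright a_i$ ($a\in M$, $a_i\in M_i$) such that $I_a:=\{i\mid\exists a_i,a\triangleright a_i\}\in\mathcal F(I)$ and $a\triangleright a_{i'}$, $a\triangleright a_i$ imply $a_{i'}\triangleright a_i$ (for factor systems also with maps $Emb_i:M_i\to M$, $Proj_i:M\to M_i$ extending the structure). A limit of $M_I$ is a target $M$ such that for every target $N'$ there is a unique map $\Phi:N'\to M$ with $b\triangleright a_i\Rightarrow\Phi(b)\triangleright a_i$; limits are unique up to isomorphism. A consistent set is $\alpha\subseteq\bigcup_iM_i$ whose elements are pairwise related by $\triangleright$ (higher stage to lower) with $\{i\mid\alpha\cap M_i\ne\emptyset\}\in\mathcal F(I)$; $\mathrm{elem}(M_I)$ is the set of inclusion-maximal consistent sets, which with the relation $\alpha\triangleright a_i\iff a_i\in\alpha$ is a limit of $M_I$. For targets $M,N$: $[M\to_{\mathcal F}N]:=\{f:M\to N\mid I_f\in\mathcal F(I\times J)\}$ with $f\triangleright f_{i\to j}$ iff for all $a\in M$, $a_i\in M_i$ with $a\triangleright a_i$, $f(a)\triangleright f_{i\to j}(a_i)$,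 and $I_f:=\{i\to j\mid\exists f_{i\to j},f\triangleright f_{i\to j}\}$. *)

(* Defs.v *)
Set Implicit Arguments.
Unset Strict Implicit.

Record dirset := DirSet {
  dcar :> Type;
  dle : dcar -> dcar -> Prop;
  dle_refl : forall i, dle i i;
  dle_trans : forall i j k, dle i j -> dle j k -> dle i k;
  dnonempty : inhabited dcar;
  ddirected : forall i j, exists k, dle i k /\ dle j k
}.
Arguments dle {d} _ _.

Definition prod_le (I J : dirset) (p q : dcar I * dcar J) : Prop :=
  dle (fst p) (fst q) /\ dle (snd p) (snd q).
Arguments prod_le : clear implicits.

Lemma prod_le_refl (I J : dirset) p : prod_le I J p p.
Proof. split; apply dle_refl. Qed.

Lemma prod_le_trans (I J : dirset) p q r :
  prod_le I J p q -> prod_le I J q r -> prod_le I J p r.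
Proof. intros [H1 H2] [H3 H4]; split; eapply dle_trans; eauto. Qed.

Lemma prod_nonempty (I J : dirset) : inhabited (dcar I * dcar J).
Proof. destruct (dnonempty I) as [i]; destruct (dnonempty J) as [j]; exact (inhabits (i, j)). Qed.
Arguments prod_nonempty : clear implicits.

Lemma prod_directed (I J : dirset) p q :
  exists r, prod_le I J p r /\ prod_le I J q r.
Proof.
  destruct (ddirected (fst p) (fst q)) as [k [H1 H2]].
  destruct (ddirected (snd p) (snd q)) as [l [H3 H4]].
  exists (k, l); split; split; assumption.
Qed.

Definition prod_dirset (I J : dirset) : dirset :=
  @DirSet (dcar I * dcar J) (prod_le I J) (@prod_le_refl I J)
          (@prod_le_trans I J) (prod_nonempty I J) (@prod_directed I J).

Definition filterfam := forall I : dirset, (dcar I -> Prop) -> Prop.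

Definition cofinal (I : dirset) (A : dcar I -> Prop) : Prop :=
  forall i, exists j, dle i j /\ A j.

Definition upclosed (I : dirset) (A : dcar I -> Prop) : Prop :=
  forall i j, dle i j -> A i -> A j.

Definition admissible (F : filterfam) : Prop :=
  forall I : dirset,
    (forall A, F I A -> cofinal A) /\
    (forall A B : dcar I -> Prop, F I A -> (forall i, A i -> B i) -> F I B) /\
    (forall A B : dcar I -> Prop, F I A -> F I B -> F I (fun i => A i /\ B i)) /\
    (forall A : dcar I -> Prop, (exists i, A i) -> upclosed A -> F I A).

Definition condD (F : filterfam) : Prop :=
  forall (I J : dirset) (H : dcar I * dcar J -> Prop) (I' : dcar I -> Prop),
    F (prod_dirset I J) H -> F I I' ->
    F J (fun j => exists i, I' i /\ H (i, j)).

Record system (I : dirset) := System {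
  st : dcar I -> Type;                                (* M_i, disjoint by typing *)
  tr : forall i' i : dcar I, st i' -> st i -> Prop    (* a_{i'} |> a_i *)
}.
Arguments st {I} s _.
Arguments tr {I} s {i' i} _ _.

Definition is_system (I : dirset) (S : system I) : Prop :=
  (forall i' i (a : st S i') (b : st S i), tr S a b -> dle i i') /\
  (forall i (a : st S i), tr S a a).

Definition eqv (I : dirset) (S : system I) (i j : dcar I) (a : st S i) (b : st S j)
  : Prop :=
  exists (k : dcar I) (c : st S k), dle i k /\ dle j k /\ tr S c a /\ tr S c b.
Arguments eqv {I} S {i j} _ _.

Definition prefactor (I : dirset) (S : system I) : Prop :=
  is_system S /\
  forall i i' (a : st S i') (b : st S i), dle i i' -> (eqv S a b <-> tr S a b).

Definition pres (I J : dirset) (S : system I) (T : system J) (i : dcar I) (j : dcar J)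
  (f : st S i -> st T j) : Prop :=
  forall a b : st S i, eqv S a b -> eqv T (f a) (f b).
Arguments pres {I J} S T {i j} _.

Record factor_data (I : dirset) (S : system I) := FactorData {
  emb : forall i i' : dcar I, dle i i' -> st S i -> st S i';
  proj : forall i i' : dcar I, dle i i' -> st S i' -> st S i
}.
Arguments emb {I S} f {i i'} _ _.
Arguments proj {I S} f {i i'} _ _.

Definition is_factor (I : dirset) (S : system I) (D : factor_data S) : Prop :=
  prefactor S /\
  (forall i i' (p : dle i i'), pres S S (emb D p)) /\
  (forall i i' (p : dle i i'), pres S S (proj D p)) /\
  (forall i (p : dle i i) (a : st S i), eqv S (emb D p a) a) /\
  (forall i (p : dle i i) (a : st S i), eqv S (proj D p a) a) /\
  (forall i i' i'' (p : dle i i') (q : dle i' i'') (r : dle i i'') (a : st S i),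
      eqv S (emb D q (emb D p a)) (emb D r a)) /\
  (forall i i' i'' (p : dle i i') (q : dle i' i'') (r : dle i i'') (a : st S i''),
      eqv S (proj D p (proj D q a)) (proj D r a)) /\
  (forall i i' (p p' : dle i i') (a : st S i),
      eqv S (proj D p (emb D p' a)) a) /\
  (forall i i' i'' (p : dle i i') (q : dle i' i'') (a' : st S i') (a : st S i),
      tr S a' a -> tr S (emb D q a') a) /\
  (forall i i' i'' (p : dle i i') (q : dle i' i'') (a'' : st S i'') (a : st S i),
      tr S a'' a -> tr S (proj D q a'') a).

Definition fun_system (I J : dirset) (SM : system I) (SN : system J)
  : system (prod_dirset I J) :=
  @System (prod_dirset I J)
    (fun p => { f : st SM (fst p) -> st SN (snd p) | pres SM SN f })
    (fun p' p f' f =>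
       prod_le I J p p' /\
       forall (a' : st SM (fst p')) (a : st SM (fst p)),
         tr SM a' a -> tr SN (proj1_sig f' a') (proj1_sig f a)).

(** * Targets and limits (a target is a carrier T with a relation a |> a_i) *)
Definition is_target (F : filterfam) (I : dirset) (S : system I) (T : Type)
  (r : T -> forall i : dcar I, st S i -> Prop) : Prop :=
  (forall a : T, F I (fun i => exists x : st S i, r a i x)) /\
  (forall (a : T) (i i' : dcar I) (x' : st S i') (x : st S i),
      dle i i' -> r a i' x' -> r a i x -> tr S x' x).
Arguments is_target F {I} S {T} r.

Definition is_limit (F : filterfam) (I : dirset) (S : system I) (T : Type)
  (r : T -> forall i : dcar I, st S i -> Prop) : Prop :=
  is_target F S r /\
  forall (T' : Type) (r' : T' -> forall i : dcar I, st S i -> Prop),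
    is_target F S r' ->
    exists! Phi : T' -> T,
      forall (b : T') (i : dcar I) (x : st S i), r' b i x -> r (Phi b) i x.
Arguments is_limit F {I} S {T} r.

Definition fun_rel (I J : dirset) (SM : system I) (SN : system J)
  (M N : Type) (rM : M -> forall i, st SM i -> Prop) (rN : N -> forall j, st SN j -> Prop)
  (f : M -> N) (p : dcar (prod_dirset I J)) (g : st (fun_system SM SN) p) : Prop :=
  forall (a : M) (x : st SM (fst p)), rM a (fst p) x -> rN (f a) (snd p) (proj1_sig g x).

Definition fun_index (I J : dirset) (SM : system I) (SN : system J)
  (M N : Type) (rM : M -> forall i, st SM i -> Prop) (rN : N -> forall j, st SN j -> Prop)
  (f : M -> N) : dcar (prod_dirset I J) -> Prop :=
  fun p => exists g : st (fun_system SM SN) p, fun_rel rM rN f g.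

Definition fun_target (F : filterfam) (I J : dirset) (SM : system I) (SN : system J)
  (M N : Type) (rM : M -> forall i, st SM i -> Prop) (rN : N -> forall j, st SN j -> Prop)
  : Type :=
  { f : M -> N | F (prod_dirset I J) (fun_index rM rN f) }.

Definition fun_target_rel (F : filterfam) (I J : dirset) (SM : system I) (SN : system J)
  (M N : Type) (rM : M -> forall i, st SM i -> Prop) (rN : N -> forall j, st SN j -> Prop)
  (f : fun_target F rM rN) (p : dcar (prod_dirset I J)) (g : st (fun_system SM SN) p)
  : Prop :=
  fun_rel rM rN (proj1_sig f) g.

(* Main.v *)
Require Import Defs.
From Stdlib Require Import IndefiniteDescription ProofIrrelevance FunctionalExtensionality.

(* Embedding a state z into all higher stages yields a consistent family, hence
   a point of the limit lying over everything z dominates; two states related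
   in [M_I] are thus seen by one point of M, which gives the coherence of
   [M ->_F N].  Conversely, a consistent family phi of [M_I -> N_J] applied to
   a point a of M, i.e. the set of all g(x) with phi |> g and a |> x, is
   consistent in [N_J] (Condition (D) makes its index set large), so it
   determines a unique point of N: this is the value at a of the unique
   mediating map. *)

Section Admissible.
Context {F : filterfam} (HF : admissible F) {I : dirset}.

Lemma admissible_cofinal {A : dcar I -> Prop} : F I A -> cofinal A.
Proof. exact (proj1 (HF I) A). Qed.

Lemma admissible_mono {A B : dcar I -> Prop} :
  F I A -> (forall i, A i -> B i) -> F I B.
Proof. exact (proj1 (proj2 (HF I)) A B). Qed.

Lemma admissible_above (i : dcar I) : F I (fun k => dle i k).
Proof.
  apply (proj2 (proj2 (proj2 (HF I)))).
  - exists i; apply dle_refl.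
  - intros k k' Hkk' Hik; exact (dle_trans Hik Hkk').
Qed.

End Admissible.

Section Consistency.
Context (F : filterfam) {I : dirset} (S : system I).

(* The paper's consistent sets, given by their membership predicates. *)
Definition consistent (R : forall i, st S i -> Prop) : Prop :=
  F I (fun i => exists x, R i x) /\
  (forall i i' (x' : st S i') (x : st S i), dle i i' -> R i' x' -> R i x -> tr S x' x).

Lemma is_target_consistent (T : Type) (r : T -> forall i, st S i -> Prop) :
  is_target F S r <-> forall t, consistent (r t).
Proof. unfold is_target, consistent; firstorder. Qed.

Lemma limit_point {T : Type} {r : T -> forall i, st S i -> Prop}
  {R : forall i, st S i -> Prop} :
  is_limit F S r -> consistent R -> exists! t, forall i x, R i x -> r t i x.
Proof.
  intros [_ Huniv] HR.
  assert (Hpt : is_target F S (fun _ : unit => R))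
    by (apply is_target_consistent; intros _; exact HR).
  destruct (Huniv unit _ Hpt) as [Phi [HPhi Huniq]].
  exists (Phi tt); split; [exact (HPhi tt)|].
  intros t Ht.
  exact (f_equal (fun f => f tt) (Huniq (fun _ => t) (fun _ => Ht))).
Qed.

End Consistency.

Arguments limit_point {F I S T r R}.

Lemma prefactor_tr_common {I : dirset} {S : system I} : prefactor S ->
  forall {k i' i} {c : st S k} {u : st S i'} {v : st S i},
  tr S c u -> tr S c v -> dle i i' -> tr S u v.
Proof.
  intros [[Hle _] Hpre] k i' i c u v Hcu Hcv Hii.
  apply (Hpre i i' u v Hii).
  exists k, c; repeat split; eauto.
Qed.

Section FactorSystem.
Context {I : dirset} {S : system I} {D : factor_data S}.
Hypothesis HD : is_factor D.

Lemma factor_is_prefactor : prefactor S.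
Proof. exact (proj1 HD). Qed.

Lemma factor_tr_refl {i} (a : st S i) : tr S a a.
Proof. exact (proj2 (proj1 factor_is_prefactor) i a). Qed.

Lemma emb_preserves_tr {i i' i''} (q : dle i' i'') {a' : st S i'} {a : st S i} :
  tr S a' a -> tr S (emb D q a') a.
Proof.
  intros Ha'a.
  destruct HD as [[[Hle _] _] [_ [_ [_ [_ [_ [_ [_ [Hemb _]]]]]]]]].
  exact (Hemb i i' i'' (Hle _ _ _ _ Ha'a) q a' a Ha'a).
Qed.

Lemma emb_tr_emb {i0 k K} (p : dle i0 k) (q : dle i0 K) (z : st S i0) :
  dle k K -> tr S (emb D q z) (emb D p z).
Proof.
  intros HkK.
  destruct HD as [Hpre [_ [_ [_ [_ [Hcomp _]]]]]].
  set (c := emb D HkK (emb D p z)).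
  assert (Hcq : tr S c (emb D q z))
    by exact (proj1 (proj2 Hpre K K c _ (dle_refl K)) (Hcomp i0 k K p HkK q z)).
  assert (Hcp : tr S c (emb D p z))
    by exact (emb_preserves_tr HkK (factor_tr_refl _)).
  exact (prefactor_tr_common Hpre Hcq Hcp HkK).
Qed.

Definition emb_cone {i0} (z : st S i0) k (x : st S k) : Prop :=
  forall K (q : dle i0 K), dle k K -> tr S (emb D q z) x.

Lemma emb_cone_consistent {F : filterfam} (HF : admissible F) {i0} (z : st S i0) :
  consistent F S (emb_cone z).
Proof.
  split.
  - apply (admissible_mono HF (admissible_above HF i0)).
    intros k p; exists (emb D p z).
    intros K q HkK; exact (emb_tr_emb p q z HkK).
  - intros i i' x' x Hii Hx' Hx.
    destruct (ddirected i' i0) as [K [Hi'K Hi0K]].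
    apply (prefactor_tr_common factor_is_prefactor (c := emb D Hi0K z)); auto.
    apply Hx; exact (dle_trans Hii Hi'K).
Qed.

Lemma factor_limit_cover {F : filterfam} (HF : admissible F)
  {M : Type} {rM : M -> forall i, st S i -> Prop} (HM : is_limit F S rM)
  {i0} (z : st S i0) : exists m, forall k x, tr S z x -> rM m k x.
Proof.
  destruct (limit_point HM (emb_cone_consistent HF z)) as [m [Hm _]].
  exists m; intros k x Hzx; apply Hm.
  intros K q _; exact (emb_preserves_tr q Hzx).
Qed.

End FactorSystem.

Section FunctionSpace.
Context {F : filterfam} (HF : admissible F) {I J : dirset}
  {SM : system I} {SN : system J}.

Lemma fun_target_is_target {DM : factor_data SM} (HDM : is_factor DM)
  {M : Type} {rM : M -> forall i, st SM i -> Prop} (HM : is_limit F SM rM)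
  {N : Type} {rN : N -> forall j, st SN j -> Prop} (HN : is_target F SN rN) :
  is_target F (fun_system SM SN) (@fun_target_rel F I J SM SN M N rM rN).
Proof.
  split.
  - intros f; exact (proj2_sig f).
  - intros f [i j] [i' j'] g' g Hle Hg' Hg; split; [exact Hle|].
    intros a' a Ha'a.
    destruct (factor_limit_cover HDM HF HM a') as [m Hm].
    exact (proj2 HN (proj1_sig f m) j j' _ _ (proj2 Hle)
             (Hg' m a' (Hm _ _ (factor_tr_refl HDM a'))) (Hg m a (Hm _ _ Ha'a))).
Qed.

Definition apply_rel (rf : forall p, st (fun_system SM SN) p -> Prop)
  (ra : forall i, st SM i -> Prop) (j : dcar J) (y : st SN j) : Prop :=
  exists i (x : st SM i) (g : st (fun_system SM SN) (i, j)),
    ra i x /\ rf (i, j) g /\ y = proj1_sig g x.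

Lemma apply_rel_consistent (HcD : condD F) {DM : factor_data SM} (HDM : is_factor DM)
  (HpreN : prefactor SN) {rf ra} :
  consistent F (fun_system SM SN) rf -> consistent F SM ra ->
  consistent F SN (apply_rel rf ra).
Proof.
  intros [Hfi Hfc] [Hai Hac]; split.
  - apply (admissible_mono HF (HcD I J _ _ Hfi Hai)).
    intros j [i [[x Hx] [g Hg]]].
    exists (proj1_sig g x), i, x, g; auto.
  - intros j j' y' y Hjj [i' [x' [g' [Hx' [Hg' ->]]]]] [i [x [g [Hx [Hg ->]]]]].
    (* Dominate x and x' by one state xl, at a stage where rf has a state gl
       above g and g'; then gl xl dominates both g x and g' x'. *)
    destruct (ddirected i i') as [k [Hik Hi'k]].
    destruct (admissible_cofinal HF Hai k) as [k' [Hkk' [xk Hxk]]].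
    destruct (admissible_cofinal HF Hfi (k', j')) as [[l jl] [[Hk'l Hj'jl] [gl Hgl]]].
    simpl in Hk'l, Hj'jl.
    set (xl := emb DM Hk'l xk).
    assert (Hxlx : tr SM xl x)
      by exact (emb_preserves_tr HDM Hk'l (Hac i k' xk x (dle_trans Hik Hkk') Hxk Hx)).
    assert (Hxlx' : tr SM xl x')
      by exact (emb_preserves_tr HDM Hk'l (Hac i' k' xk x' (dle_trans Hi'k Hkk') Hxk Hx')).
    assert (Hglg : tr (fun_system SM SN) gl g).
    { apply (Hfc (i, j) (l, jl)); auto.
      split; simpl; eauto using dle_trans. }
    assert (Hglg' : tr (fun_system SM SN) gl g').
    { apply (Hfc (i', j') (l, jl)); auto.
      split; simpl; eauto using dle_trans. }
    exact (prefactor_tr_common HpreN (proj2 Hglg' _ _ Hxlx') (proj2 Hglg _ _ Hxlx) Hjj).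
Qed.

Lemma fun_target_universal (HcD : condD F) {DM : factor_data SM} (HDM : is_factor DM)
  (HpreN : prefactor SN)
  {M : Type} {rM : M -> forall i, st SM i -> Prop} (HM : is_target F SM rM)
  {N : Type} {rN : N -> forall j, st SN j -> Prop} (HN : is_limit F SN rN)
  {T' : Type} {r' : T' -> forall p, st (fun_system SM SN) p -> Prop} :
  is_target F (fun_system SM SN) r' ->
  exists! Phi : T' -> fun_target F rM rN,
    forall b p g, r' b p g -> fun_target_rel (Phi b) g.
Proof.
  intros Hr'.
  set (value := fun (ba : T' * M) (n : N) =>
         forall j y, apply_rel (r' (fst ba)) (rM (snd ba)) j y -> rN n j y).
  assert (Hvalue : forall ba, exists! n, value ba n).
  { intros [b a]; apply (limit_point HN).
    apply (apply_rel_consistent HcD HDM HpreN).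
    - exact (proj1 (is_target_consistent F _ _ r') Hr' b).
    - exact (proj1 (is_target_consistent F _ _ rM) HM a). }
  destruct (functional_choice value
              (fun ba => proj1 (proj2 (unique_existence _) (Hvalue ba)))) as [h Hh].
  assert (Hrel : forall b p g, r' b p g -> fun_rel rM rN (fun a => h (b, a)) g).
  { intros b [i j] g Hg a x Hx; apply (Hh (b, a)); exists i, x, g; auto. }
  assert (Hidx : forall b, F (prod_dirset I J) (fun_index rM rN (fun a => h (b, a)))).
  { intros b; apply (admissible_mono HF (proj1 Hr' b)).
    intros p [g Hg]; exists g; exact (Hrel b p g Hg). }
  exists (fun b => exist _ (fun a => h (b, a)) (Hidx b)); split; [exact Hrel|].
  intros Psi HPsi; apply functional_extensionality; intros b.
  apply eq_sig_hprop; [intros; apply proof_irrelevance|].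
  apply functional_extensionality; intros a; simpl.
  destruct (Hvalue (b, a)) as [n [_ Huniq]].
  transitivity n; [symmetry; exact (Huniq _ (Hh (b, a)))|].
  apply Huniq; intros j y [i [x [g [Hx [Hg ->]]]]].
  exact (HPsi b (i, j) g Hg a x Hx).
Qed.

End FunctionSpace.

Theorem corollary2p15 :
  forall (F : filterfam), admissible F -> condD F ->
  forall (I J : dirset)
         (SM : system I) (DM : factor_data SM), is_factor DM ->
  forall (SN : system J) (DN : factor_data SN), is_factor DN ->
  forall (M : Type) (rM : M -> forall i : dcar I, st SM i -> Prop),
    is_limit F SM rM ->
  forall (N : Type) (rN : N -> forall j : dcar J, st SN j -> Prop),
    is_limit F SN rN ->
  is_limit F (fun_system SM SN) (@fun_target_rel F I J SM SN M N rM rN).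
Proof.
  intros F HF HcD I J SM DM HDM SN DN HDN M rM HM N rN HN.
  split.
  - exact (fun_target_is_target HF HDM HM (proj1 HN)).
  - intros T' r' Hr'.
    exact (fun_target_universal HF HcD HDM (factor_is_prefactor HDN) (proj1 HM) HN Hr').
Qed.
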